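(* Let $n$ and $k$ be integers with $0<k<n$, let $\delta_1,\ldots,\delta_n$ be distinct real numbers with $\delta_j<0$ for all $j$, let $t\in\mathbb{R}$ and, for $h>0$, let $I_h$ be the smallest closed interval containing $t$ and all the points $t+\delta_i h$, $1\le i\le n$. Let $f$ be a real-valued function that is $n$-times differentiable on an open set containing $I_{h_0}$ for some $h_0>0$. For $0<h\le h_0$ let $$E(h)=\frac{1}{h^k}\sum_{j=1}^n c_j f(t+\delta_j h),\qquad R(h)=f^{(k)}(t)-E(h).$$ 1. If $f^{(n)}(t)>0$, then $R(h)>0$ for all sufficiently small $h>0$, i.e. the estimate $E(h)$ of $f^{(k)}(t)$ is an underestimate: $E(h)<f^{(k)}(t)$. 2. If $f^{(n)}(t)<0$, then $R(h)<0$ for all sufficiently small $h>0$, i.e. the estimate $E(h)$ of $f^{(k)}(t)$ is an overestimate: $E(h)>f^{(k)}(t)$.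
   Context: $(c_1,\ldots,c_n)\in\mathbb{R}^n$ is the unique vector (independent of $h$) satisfying $\sum_{j=1}^n c_j\delta_j^i=0$ for all $0\le i\le n-1$ with $i\ne k$, and $\sum_{j=1}^n c_j\delta_j^k=k!$ (existence and uniqueness follow from invertibility of the Vandermonde matrix). *)

(* Defs.v *)
From HB Require Import structures.
From mathcomp Require Import all_boot all_order all_algebra.
From mathcomp Require Import all_classical all_reals all_analysis.
Import Order.TTheory GRing.Theory Num.Theory.
Import numFieldNormedType.Exports.
Set Implicit Arguments.
Unset Strict Implicit.
Unset Printing Implicit Defensive.
Local Open Scope ring_scope.
Local Open Scope classical_set_scope.

(* The value of [f^`(m).+1] at a point is meaningful only if [f^`(m)] is
   derivable there, hence all the orders below [n] are required. On an open
   [U], the values of the total function [f] outside [U] play no role. *)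
Definition derivable_n_on (R : realType) (n : nat) (U : set R) (f : R -> R) :=
  forall m, (m < n)%N -> forall x, U x -> derivable f^`(m) x 1.

Definition sample_points (R : realType) (n : nat) (delta : 'I_n -> R)
    (t h : R) : set R :=
  t |` [set t + delta i * h | i in [set: 'I_n]].

Definition sample_interval (R : realType) (n : nat) (delta : 'I_n -> R)
    (t h : R) : set R :=
  smallest [set J : set R | exists a b : R, J = `[a, b]]
           (sample_points delta t h).

Definition fd_weights (R : realType) (n : nat) (delta : 'I_n -> R) (k : nat)
    (c : 'I_n -> R) : Prop :=
  (forall i, (i < n)%N -> i != k -> \sum_(j < n) c j * delta j ^+ i = 0) /\
  \sum_(j < n) c j * delta j ^+ k = k`!%:R.

Lemma fd_weights_exists_unique (R : realType) (n k : nat) (delta : 'I_n -> R) :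
  (k < n)%N -> injective delta -> exists! c, fd_weights delta k c.
Proof.
move=> kn dinj; pose k0 := Ordinal kn.
pose V := Vandermonde n (\row_j delta j).
pose b : 'cV[R]_n := k`!%:R *: delta_mx k0 0.
have Vu : V \in unitmx.
  rewrite unitmxE det_Vandermonde unitfE; apply/prodf_neq0 => i _.
  apply/prodf_neq0 => j ij; rewrite !mxE subr_eq0.
  by apply: contraTneq ij => /dinj ->; rewrite ltnn.
have E (c : 'I_n -> R) : fd_weights delta k c <-> V *m (\col_j c j) = b.
  have S i : (V *m (\col_j c j)) i 0 = \sum_(j < n) c j * delta j ^+ i.
    by rewrite mxE; apply: eq_bigr => j _; rewrite !mxE mulrC.
  split=> [[c0 ck]|e].
    apply/matrixP => i j; rewrite !(ord1 j) S !mxE eqxx andbT -val_eqE /=.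
    by case: eqP => [->|/eqP ik]; rewrite ?mulr1 ?mulr0 // c0.
  split=> [i ni ik|].
    by have /= <- := S (Ordinal ni); rewrite e !mxE -val_eqE /= (negbTE ik) mulr0.
  by have /= <- := S k0; rewrite e !mxE !eqxx mulr1.
have colK (x : 'cV[R]_n) : \col_j x j 0 = x.
  by apply/matrixP => i j; rewrite mxE (ord1 j).
exists (fun j => (invmx V *m b) j 0); split.
  by apply/E; rewrite colK mulKVmx.
move=> c /E Vc; apply/funext => j.
by rewrite -Vc mulKmx // mxE.
Qed.

Definition fd_estimate (R : realType) (n : nat) (delta : 'I_n -> R) (k : nat)
    (c : 'I_n -> R) (f : R -> R) (t h : R) : R :=
  (h ^+ k)^-1 * \sum_(j < n) c j * f (t + delta j * h).

Definition fd_remainder (R : realType) (n : nat) (delta : 'I_n -> R) (k : nat)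
    (c : 'I_n -> R) (f : R -> R) (t h : R) : R :=
  f^`(k)%classic t - fd_estimate delta k c f t h.

(* Main.v *)
Require Import Defs.
From HB Require Import structures.
From mathcomp Require Import all_boot all_order all_algebra.
From mathcomp Require Import all_classical all_reals all_analysis.
From mathcomp Require Import ring.
Import Order.TTheory GRing.Theory Num.Theory.
Import numFieldNormedType.Exports.
Local Open Scope ring_scope.
Local Open Scope classical_set_scope.

(** The estimate uses [n] points to the left of [t], with weights that
    differentiate polynomials of degree below [n] exactly; the sign of the
    error is therefore decided by the Taylor term of order [n].

    Insert the expansion f (t + x) = T x + o(x ^ n), where T is the Taylor
    polynomial of f at [t] of degree [n], into the estimate.  By the moment
    conditions on the weights, the terms of degree below [n] contribute exactly
    f^(k) t, so that
    R h = - M / n! * f^(n) t * h ^ (n - k) + o(h ^ (n - k)), where M is the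
    moment of order [n] of the weights ([fd_remainder_cvg]).  Since f^(n) is
    not supposed continuous at [t], the Taylor remainder has to be taken in
    Peano-Young form ([taylor_young]); it is controlled by iterating
    L'Hopital's rule, down to the definition of the derivative at [t].

    It remains to see that M < 0 ([fd_weights_moment_lt0]).  Let P be the monic
    polynomial of degree [n] whose roots are the nodes delta_j.  Applied to P,
    the weights give 0; computed from the moments, they give P_k * k! + M.
    All the roots being negative, all the coefficients of P are positive, so
    M = - P_k * k! < 0. *)

Lemma coef_prod_XsubC_gt0 (R : realDomainType) (s : seq R) (i : nat) :
  all (fun a => a < 0) s -> (i <= size s)%N ->
  0 < (\prod_(a <- s) ('X - a%:P))`_i.
Proof.
elim: s i => [|a s IHs] i /=.
  by rewrite leqn0 big_nil => _ /eqP ->; rewrite coef1 ltr01.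
move=> /andP[a0 s0] is1; rewrite big_cons mulrBl coefB coefXM coefCM -mulNr.
have q0 j : 0 <= (\prod_(b <- s) ('X - b%:P))`_j.
  have [js|sj] := leqP j (size s); first exact/ltW/IHs.
  by rewrite nth_default // size_prod_XsubC.
case: i is1 => [_|i is1] /=.
  by rewrite add0r mulr_gt0 ?oppr_gt0 ?IHs.
by rewrite ltr_pwDl ?IHs // mulr_ge0 // oppr_ge0 ltW.
Qed.

Section weights.
Context {R : realType} {n k : nat} {delta c : 'I_n -> R}.

(** In degree at most [n] the weights act as extraction of the [k]-th derivative
    at 0, up to an error proportional to the coefficient of degree [n]. *)
Lemma fd_weights_poly (p : {poly R}) :
  (k < n)%N -> fd_weights delta k c -> (size p <= n.+1)%N ->
  \sum_(j < n) c j * p.[delta j] =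
    p`_k * k`!%:R + p`_n * \sum_(j < n) c j * delta j ^+ n.
Proof.
move=> kn [c0 ck] sp.
under eq_bigr do rewrite (horner_coef_wide _ sp) mulr_sumr.
rewrite exchange_big /= big_ord_recr /=; congr (_ + _); last first.
  by rewrite mulr_sumr; apply: eq_bigr => j _; rewrite mulrCA.
rewrite (bigD1 (Ordinal kn)) //= [X in _ + X]big1 ?addr0 => [|i ik].
  by rewrite -ck mulr_sumr; apply: eq_bigr => j _; rewrite mulrCA.
under eq_bigr do rewrite mulrCA.
by rewrite -mulr_sumr c0 ?mulr0 // -val_eqE.
Qed.

(** Evaluate the weights on the monic polynomial that vanishes at every node. *)
Lemma fd_weights_moment_lt0 :
  (k < n)%N -> (forall j, delta j < 0) -> fd_weights delta k c ->
  \sum_(j < n) c j * delta j ^+ n < 0.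
Proof.
move=> kn dneg hc.
set s := [seq delta j | j <- enum 'I_n].
have szs : size s = n by rewrite size_map size_enum_ord.
pose P := \prod_(a <- s) ('X - a%:P).
have szP : size P = n.+1 by rewrite size_prod_XsubC szs.
have pk : 0 < P`_k.
  apply: coef_prod_XsubC_gt0; last by rewrite szs ltnW.
  by apply/allP => _ /mapP[j _ ->]; exact: dneg.
have P0 : \sum_(j < n) c j * P.[delta j] = 0.
  apply: big1 => j _; suff /eqP -> : root P (delta j) by rewrite mulr0.
  by rewrite root_prod_XsubC map_f ?mem_enum.
have pn : P`_n = 1.
  have /monicP : P \is monic by exact: monic_prod_XsubC.
  by rewrite lead_coefE szP.
move: P0; rewrite fd_weights_poly ?szP // pn mul1r => /eqP.
rewrite addrC addr_eq0 => /eqP ->.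
by rewrite oppr_lt0 mulr_gt0 // ltr0n fact_gt0.
Qed.
End weights.

Definition taylor_poly {R : realType} (f : R -> R) (t : R) (n : nat) :
  {poly R} :=
  \poly_(i < n.+1) (f^`(i)%classic t / i`!%:R).

(** This is what makes L'Hopital's rule reproduce the same quotient for [f^`()]
    one degree lower. *)
Lemma deriv_taylor_poly {R : realType} (f : R -> R) t n :
  deriv (taylor_poly f t n.+1) = taylor_poly f^`()%classic t n.
Proof.
apply/polyP => i; rewrite coef_deriv !coef_poly ltnS.
case: ifP => _; last by rewrite mul0rn.
rewrite derive1Sn -[LHS]mulr_natr -mulrA; congr (_ * _).
by rewrite factS natrM invfM -mulrA mulrCA mulVf ?mulr1.
Qed.

Lemma taylor_poly0 {R : realType} (f : R -> R) t n :
  (taylor_poly f t n).[0] = f t.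
Proof. by rewrite horner_coef0 coef_poly /= fact0 divr1. Qed.

(** Differentiating numerator and denominator turns the quotient of order [n.+1]
    for [f] into that of order [n] for [f^`()], up to the factor [n.+1]; order 1
    is the definition of the derivative.  The limit can be taken over full
    neighbourhoods of 0 because the quotient is 0 there by the convention
    0^-1 = 0. *)
Lemma taylor_young {R : realType} (f : R -> R) (t : R) (n : nat) :
  (0 < n)%N ->
  (\forall x \near t, forall m, (m < n)%N -> derivable f^`(m) x 1) ->
  (f (t + x) - (taylor_poly f t n).[x]) / x ^+ n @[x --> (0 : R)] --> (0 : R).
Proof.
pose q g m (x : R) := (g (t + x) - (taylor_poly g t m.+1).[x]) / x ^+ m.+1.
have q0 g m : q g m 0 = 0 by rewrite /q exprS mul0r invr0 mulr0.
have undelete g m : q g m x @[x --> 0^'] --> (0 : R) ->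
    q g m x @[x --> (0 : R)] --> (0 : R).
  rewrite -[X in _ --> X -> _](q0 g m) -[X in _ -> _ --> X](q0 g m).
  by move=> /continuous_withinNx.
case: n => // n _; elim: n f => [|n IHn] f df; apply: undelete.
  have df1 : derivable f t 1 by exact: (nbhs_singleton df 0%N).
  have : h^-1 *: ((f \o shift t) (h *: (1:R)) - f t) - f^`()%classic t
      @[h --> 0^'] --> (0:R).
    rewrite -[X in _ --> X](subrr (f^`()%classic t)).
    apply: cvgB; last exact: cvg_cst.
    by rewrite derive1E; exact: df1.
  apply: cvg_trans; apply: near_eq_cvg; near=> h.
  have h0 : h != 0 by near: h; exact: nbhs_dnbhs_neq.
  rewrite /q /taylor_poly poly_def 2!big_ord_recl big_ord0 /= fact0 addr0 !divr1.
  rewrite expr0 !hornerE /= expr1 [h%:A]mulr1 [h + t]addrC opprD addrA mulrBl.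
  by rewrite mulfK //; congr (_ - _); exact: mulrC.
pose g x : R := f (t + x) - (taylor_poly f t n.+2).[x].
pose dg x : R := f^`()%classic (t + x) - (taylor_poly f^`()%classic t n.+1).[x].
have /nbhs_ballP[e /= e0 edf] := df.
have dgP x : x \in `]- e, e[%R -> is_derive x 1 g (dg x).
  move=> xe; rewrite /dg -deriv_taylor_poly; apply: is_deriveB.
  rewrite -[X in is_derive _ _ _ X]mulr1.
  have : derivable f (t + x) 1.
    apply: (edf _ _ 0%N) => //.
    rewrite in_itv /= -ltr_norml in xe.
    by rewrite -ball_normE /ball_ /= opprD addNKr normrN.
  move=> /derivableP; rewrite -derive1E => dfx.
  apply: (@is_derive1_comp _ f (fun x => t + x)) => //.
  have := is_derive_shift x 1 t; rewrite /shift.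
  by under eq_fun do rewrite addrC.
have dX (x : R) : is_derive x 1 (fun x => x ^+ n.+2 : R) (n.+2%:R * x ^+ n.+1).
  rewrite (_ : (fun x => _) = horner 'X^(n.+2)); last first.
    by apply/funext => y; rewrite hornerXn.
  have := is_derive_poly 'X^(n.+2) x.
  by rewrite derivXn hornerMn hornerXn mulr_natl.
have e0e : (0:R) \in `]- e, e[%R by rewrite in_itv /= oppr_lt0 e0.
have cX (m : nat) : (x : R) ^+ m.+1 @[x --> (0 : R)] --> (0 : R).
  rewrite -[X in _ --> X](expr0n R m.+1); exact: exprn_continuous.
apply: (lhopital e0e (df := dg) (dg := fun x => n.+2%:R * x ^+ n.+1)).
- by move=> x /set_mem[/= xe _]; apply: dgP.
- have g0 : g 0 = 0 by rewrite /g addr0 taylor_poly0 subrr.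
  rewrite -[X in _ --> X]g0.
  apply/differentiable_continuous/derivable1_diffP.
  by have [] := dgP _ e0e.
- exact: cX.
- by move=> x /set_mem[/= _ /eqP x0]; rewrite mulf_neq0 ?pnatr_eq0 ?expf_neq0 //.
have dfS : \forall x \near t, forall m, (m < n.+1)%N ->
    derivable (f^`()%classic)^`(m) x 1.
  by apply: filterS df => x dfx m mn; rewrite -derive1Sn; exact: dfx.
have : dg x / x ^+ n.+1 * n.+2%:R^-1 @[x --> (0 : R)] --> (0 : R).
  rewrite -[X in _ --> X](mul0r (n.+2%:R^-1 : R)).
  by apply: cvgM; [exact: IHn|exact: cvg_cst].
apply: cvg_trans; apply: near_eq_cvg; near=> x.
by rewrite invfM mulrA [RHS]mulrAC.
Unshelve. all: by end_near. Qed.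

(** The limit is the coefficient of [h ^+ (n - k)] left once the moment conditions
    have removed the lower terms of the Taylor expansion; the [j]-th node
    contributes [o(h ^+ n)] to the rest because [delta j * h] tends to 0. *)
Lemma fd_remainder_cvg {R : realType} {n k : nat} {delta c : 'I_n -> R}
    {t : R} {f : R -> R} :
  (k < n)%N -> fd_weights delta k c ->
  (\forall x \near t, forall m, (m < n)%N -> derivable f^`(m) x 1) ->
  fd_remainder delta k c f t h / h ^+ (n - k) @[h --> 0^'+] -->
    - (\sum_(j < n) c j * delta j ^+ n) / n`!%:R * f^`(n)%classic t.
Proof.
move=> kn hc df; set M := \sum_(j < n) _.
set T := taylor_poly f t n.
pose q x := (f (t + x) - T.[x]) / x ^+ n.
have n0 : (0 < n)%N by exact: leq_ltn_trans kn.
(* At 0 the quotient [q] is 0, but so is the Taylor remainder. *)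
have fE x : f (t + x) = T.[x] + q x * x ^+ n.
  have [->|x0] := eqVneq x 0; last first.
    by rewrite /q divfK ?expf_neq0 // [RHS]addrC subrK.
  by rewrite expr0n gtn_eqF // mulr0 !addr0 taylor_poly0.
(* The weights are applied to x |-> T (x * h), whose coefficients are those of
   [T] scaled by the powers of [h]. *)
have sumT h : \sum_(j < n) c j * T.[delta j * h] =
    f^`(k)%classic t * h ^+ k + f^`(n)%classic t / n`!%:R * h ^+ n * M.
  pose p := \poly_(i < n.+1) (f^`(i)%classic t / i`!%:R * h ^+ i).
  have pE x : T.[x * h] = p.[x].
    rewrite !horner_poly; apply: eq_bigr => i _.
    by rewrite exprMn mulrA mulrAC.
  under eq_bigr do rewrite pE.
  rewrite (fd_weights_poly _ kn hc (size_poly _ _)) !coef_poly.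
  rewrite ltnS ltnSn (ltnW kn).
  by rewrite mulrAC divfK // pnatr_eq0 -lt0n fact_gt0.
have q0 : \sum_(j < n) c j * delta j ^+ n * q (delta j * h)
    @[h --> 0^'+] --> (0:R).
  rewrite [X in _ --> X](_ : 0 = \sum_(j < n) (0 : R)); last by rewrite big1.
  apply: cvg_big => [|j _]; first exact: add_continuous.
  rewrite -[X in _ --> X](mulr0 (c j * delta j ^+ n)).
  apply: cvgM; first exact: cvg_cst.
  have dh0 : delta j * h @[h --> (0 : R)] --> (0 : R).
    rewrite -[X in _ --> X](mulr0 (delta j)).
    by apply: cvgM; [exact: cvg_cst|exact: cvg_id].
  apply: cvg_at_right_filter.
  by apply: (@cvg_comp _ _ _ ( *%R (delta j)) q _ (nbhs 0));
    [exact: dh0|exact: taylor_young].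
rewrite -[X in _ --> X]subr0.
apply: cvg_trans (cvgB (cvg_cst _) q0); apply: near_eq_cvg; near=> h.
have h0 : h != 0 by rewrite gt_eqF.
rewrite /fd_remainder /fd_estimate.
under [X in _ = (_ - _ * X) / _]eq_bigr do rewrite fE mulrDr exprMn.
rewrite big_split /= sumT.
have -> : \sum_(i < n) c i * (q (delta i * h) * (delta i ^+ n * h ^+ n)) =
  (\sum_(j < n) c j * delta j ^+ n * q (delta j * h)) * h ^+ n.
  rewrite mulr_suml; apply: eq_bigr => j _.
  by rewrite mulrA mulrA; congr (_ * _); rewrite mulrAC.
have -> : h ^+ n = h ^+ (n - k) * h ^+ k by rewrite -exprD subnK // ltnW.
set Q := \sum_(j < n) _.
have hk0 : h ^+ k != 0 by rewrite expf_neq0.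
have hnk0 : h ^+ (n - k) != 0 by rewrite expf_neq0.
have nf0 : n`!%:R != 0 :> R by rewrite pnatr_eq0 -lt0n fact_gt0.
rewrite [LHS](_ : _ = - M / n`!%:R * f^`(n)%classic t - Q) //.
by field; rewrite hk0 hnk0 nf0.
Unshelve. all: by end_near. Qed.

Theorem theorem3 (R : realType) (n k : nat) (hk0 : (0 < k)%N) (hkn : (k < n)%N)
    (delta : 'I_n -> R) (hdist : injective delta)
    (hneg : forall j, delta j < 0)
    (c : 'I_n -> R) (hc : fd_weights delta k c)
    (t h0 : R) (hh0 : 0 < h0)
    (f : R -> R) (U : set R) (hU : open U)
    (hIU : sample_interval delta t h0 `<=` U)
    (hf : derivable_n_on n U f) :
  (0 < f^`(n)%classic t ->
     \forall h \near 0^'+, 0 < fd_remainder delta k c f t h /\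
                           fd_estimate delta k c f t h < f^`(k)%classic t) /\
  (f^`(n)%classic t < 0 ->
     \forall h \near 0^'+, fd_remainder delta k c f t h < 0 /\
                           f^`(k)%classic t < fd_estimate delta k c f t h).
Proof.
have Ut : U t by apply: hIU; apply: sub_gen_smallest; left.
have df : \forall x \near t, forall m, (m < n)%N -> derivable f^`(m) x 1.
  have : \near t, U t by exact: open_nbhs_nbhs.
  by apply: filterS => x Ux m mn; exact: hf.
have lim := fd_remainder_cvg hkn hc df.
have K0 : 0 < - (\sum_(j < n) c j * delta j ^+ n) / n`!%:R.
  by rewrite divr_gt0 ?ltr0n ?fact_gt0 // oppr_gt0 (fd_weights_moment_lt0 hkn).
split=> fn.
  have L0 := mulr_gt0 K0 fn.
  near=> h.
  have R0 : 0 < fd_remainder delta k c f t h.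
    rewrite -(@pmulr_lgt0 _ (h ^- (n - k))) ?invr_gt0 ?exprn_gt0 //.
    by near: h; exact: (cvgr_gt _ lim).
  by split; rewrite // -subr_gt0.
have L0 : - (\sum_(j < n) c j * delta j ^+ n) / n`!%:R * f^`(n)%classic t < 0.
  by rewrite pmulr_rlt0.
near=> h.
have R0 : fd_remainder delta k c f t h < 0.
  rewrite -(@pmulr_llt0 _ (h ^- (n - k))) ?invr_gt0 ?exprn_gt0 //.
  by near: h; exact: (cvgr_lt _ lim).
by split; rewrite // -subr_lt0.
Unshelve. all: by end_near. Qed.
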